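(* Let $b\in\mathbb{R}^n\setminus\mathbb{Z}^n$ and let $(\pi,\alpha)$ be a nontrivial valid tuple for $I_b$. Then $(\pi,\alpha)$ is liftable if and only if there exists a minimal valid tuple $(\pi',\alpha)$ for $I_b$ such that $\pi'\le\pi$ and $\sup_{\epsilon>0}\frac{\pi'(\epsilon r)}{\epsilon}<\infty$ for every $r\in\mathbb{R}^n$. In this case, defining $\psi(r)=\sup_{\epsilon>0}\frac{\pi'(\epsilon r)}{\epsilon}$ for $r\in\mathbb{R}^n$, the tuple $(\psi,\pi',\alpha)$ is a nontrivial valid tuple for $M_b$ which is minimal.
   Context: $M_b$ is the set of all pairs $(s,y)$ of finite-support functions $s:\mathbb{R}^n\to\mathbb{R}_+$, $y:\mathbb{R}^n\to\mathbb{Z}_+$ such that $\sum_{r\in\mathbb{R}^n} r\,s(r)+\sum_{p\in\mathbb{R}^n}p\,y(p)\in b+\mathbb{Z}^n$. $I_b$ is the set of finite-support $y:\mathbb{R}^n\to\mathbb{Z}_+$ with $(0,y)\in M_b$. A tuple $(\psi,\pi,\alpha)$ with $\psi,\pi:\mathbb{R}^n\to\mathbb{R}$ is valid for $M_b$ if $\sum_r\psi(r)s(r)+\sum_p\pi(p)y(p)\ge\alpha$ for all $(s,y)\in M_b$; a tuple $(\pi,\alpha)$ with $\pi:\mathbb{R}^n\to\mathbb{R}$ is valid for $I_b$ if $\sum_p\pi(p)y(p)\ge\alpha$ for all $y\in I_b$. By positive rescaling, all tuples are assumed to have $\alpha\in\{-1,0,1\}$. A valid tuple $(\psi,\pi,\alpha)$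 for $M_b$ is minimal if there is no $(\psi',\pi')\neq(\psi,\pi)$ with $\psi'\le\psi$, $\pi'\le\pi$ pointwise and $(\psi',\pi',\alpha)$ valid for $M_b$; a valid tuple $(\pi,\alpha)$ for $I_b$ is minimal if there is no $\pi'\ne\pi$ with $\pi'\le\pi$ pointwise and $(\pi',\alpha)$ valid for $I_b$. A valid tuple $(\psi,\pi,\alpha)$ for $M_b$ is trivial if $\psi\ge0$, $\pi\ge0$ and $\alpha\in\{0,-1\}$; a valid tuple $(\pi,\alpha)$ for $I_b$ is trivial if $\pi\ge0$ and $\alpha\in\{0,-1\}$; nontrivial means not trivial. A valid tuple $(\pi,\alpha)$ for $I_b$ is liftable if there exists $\psi:\mathbb{R}^n\to\mathbb{R}$ such that $(\psi,\pi,\alpha)$ is a valid tuple for $M_b$. *)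

(* Defs.v *)
From HB Require Import structures.
From mathcomp Require Import all_boot all_order all_algebra.
From mathcomp Require Import all_classical all_reals ereal.

Set Implicit Arguments.
Unset Strict Implicit.
Unset Printing Implicit Defensive.

Import Order.TTheory GRing.Theory Num.Theory.

Local Open Scope classical_set_scope.
Local Open Scope ring_scope.

Definition finitely_supported (T : Type) (V : nmodType) (f : T -> V) : Prop :=
  finite_set [set x | f x != 0].

Section InfiniteModels.
Context {R : realType} {n : nat}.
Local Notation Rn := ('rV[R]_n).

Definition Zn : set Rn := [set z | forall i, z 0 i \is a Num.int].

Definition mixed_model (b : Rn) : set ((Rn -> R) * (Rn -> nat)) :=
  [set sy | [/\ finitely_supported sy.1, finitely_supported sy.2,
     forall r, 0 <= sy.1 r &
     [set b + z | z in Zn]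
       (\sum_(r \in [set: Rn]) sy.1 r *: r + \sum_(p \in [set: Rn]) p *+ sy.2 p)]].

Definition integer_model (b : Rn) : set (Rn -> nat) :=
  [set y | mixed_model b (fun=> 0, y)].

(* Tuples are normalized by positive rescaling, so that alpha is -1, 0 or 1. *)
Definition normalized (alpha : R) : Prop :=
  [\/ alpha = -1, alpha = 0 | alpha = 1].

Definition validM (b : Rn) (psi pi : Rn -> R) (alpha : R) : Prop :=
  normalized alpha /\
  forall s y, mixed_model b (s, y) ->
    alpha <= \sum_(r \in [set: Rn]) psi r * s r
             + \sum_(p \in [set: Rn]) pi p * (y p)%:R.

Definition validI (b : Rn) (pi : Rn -> R) (alpha : R) : Prop :=
  normalized alpha /\
  forall y, integer_model b y ->
    alpha <= \sum_(p \in [set: Rn]) pi p * (y p)%:R.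

Definition minimalM (b : Rn) (psi pi : Rn -> R) (alpha : R) : Prop :=
  validM b psi pi alpha /\
  ~ exists psi' pi', [/\ (psi', pi') <> (psi, pi),
      forall r, psi' r <= psi r, forall p, pi' p <= pi p &
      validM b psi' pi' alpha].

Definition minimalI (b : Rn) (pi : Rn -> R) (alpha : R) : Prop :=
  validI b pi alpha /\
  ~ exists pi', [/\ pi' <> pi, forall p, pi' p <= pi p & validI b pi' alpha].

Definition trivialM (psi pi : Rn -> R) (alpha : R) : Prop :=
  [/\ forall r, 0 <= psi r, forall p, 0 <= pi p & alpha = 0 \/ alpha = -1].

Definition trivialI (pi : Rn -> R) (alpha : R) : Prop :=
  (forall p, 0 <= pi p) /\ (alpha = 0 \/ alpha = -1).

Definition liftable (b : Rn) (pi : Rn -> R) (alpha : R) : Prop :=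
  exists psi : Rn -> R, validM b psi pi alpha.

Definition sup_slope (pi : Rn -> R) (r : Rn) : \bar R :=
  ereal_sup [set (pi (eps *: r) / eps)%:E | eps in [set eps : R | 0 < eps]].

End InfiniteModels.

(* Main.v *)
Require Import Defs.
From HB Require Import structures.
From mathcomp Require Import all_boot all_order all_algebra.
From mathcomp Require Import all_classical all_reals ereal.
From mathcomp Require Import ring lra.

Set Implicit Arguments.
Unset Strict Implicit.
Unset Printing Implicit Defensive.

Import Order.TTheory GRing.Theory Num.Theory.

Local Open Scope classical_set_scope.
Local Open Scope ring_scope.

(* Let (psi, pi, alpha) be valid for M_b. Completing k copies of p by fractional
   multiples of the unit vectors costs a bounded amount, so pi >= 0, and
   nontriviality forces alpha = 1. Fixing psi, Zorn's lemma gives a minimal pi'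
   below pi with (psi, pi', 1) valid. Minimality yields pi'(p) <= psi.s + pi'.y
   whenever (s, y) represents p modulo Z^n, since otherwise pi'(p) could be
   lowered to that cost. In particular pi'(eps r) <= eps psi(r), and pi' is
   symmetric: pi'(p) + pi'(b - p) = 1. Symmetry makes pi' minimal for I_b, even
   against functions that are not liftable.

   Conversely, if pi' is minimal for I_b with finite slopes, moving each s(r) r
   to the integer part does not increase the cost, so (psi, pi') is valid for
   M_b; and no psi' valid with pi' can satisfy eps psi'(r) < pi'(eps r), since
   pi'(eps r) could then be lowered to eps psi'(r). *)

(** * Sums over finite supports as sums over sequences *)

Section FiniteSums.

Lemma sum_count_mem (T : choiceType) (V : nmodType) (h : T -> V) (l : seq T) :
  \sum_(p \in [set: T]) h p *+ count_mem p l = \sum_(p <- l) h p.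
Proof.
rewrite (fsbigE (undup l)) ?undup_uniq//; last first.
  by move=> p _; rewrite mem_undup => /count_memPn ->; rewrite mulr0n.
rewrite -[RHS]big_undup_iterop_count; apply: eq_big => [p|p _].
  by rewrite in_setT.
by rewrite Monoid.iteropE iter_addr_0.
Qed.

Lemma sum_weights (T : choiceType) (R : pzRingType) (V : lmodType R)
    (h : T -> V) (l : seq (R * T)) :
  \sum_(r \in [set: T]) (\sum_(x <- l | x.2 == r) x.1) *: h r =
  \sum_(x <- l) x.1 *: h x.2.
Proof.
rewrite (fsbigE (undup [seq x.2 | x <- l])) ?undup_uniq//; last first.
  move=> r _; rewrite mem_undup => rl; rewrite big_seq_cond big_pred0 ?scale0r//.
  move=> x; apply/negP => /andP[xl /eqP xr].
  by move/negP: rl; apply; rewrite -xr; apply/mapP; exists x.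
under eq_bigl do rewrite in_setT.
under eq_bigr do rewrite scaler_suml big_mkcond.
rewrite exchange_big/=; apply: eq_big_seq => x xl.
rewrite (bigD1_seq x.2) ?undup_uniq//=; last by rewrite mem_undup map_f.
by rewrite eqxx big1 ?addr0// => r; rewrite eq_sym => /negbTE ->.
Qed.

Lemma finitely_supportedE (T : choiceType) (V : nmodType) (f : T -> V) :
  finitely_supported f ->
  exists2 u : seq T, uniq u & forall p, p \notin u -> f p = 0.
Proof.
move=> /finite_seqP[u fu]; exists (undup u); first exact: undup_uniq.
move=> p; rewrite mem_undup => pu; apply/eqP/negPn/negP => fp.
by move/negP: pu; apply; have : [set x | f x != 0] p by []; rewrite fu.
Qed.

End FiniteSums.

(** * Solutions encoded as pairs of finite lists *)

Section Lists.
Context {R : realType} {n : nat}.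
Local Notation Rn := ('rV[R]_n).
Implicit Types (b p q r : Rn) (psi pi : Rn -> R) (alpha : R).
Implicit Types (l : seq (R * Rn)) (m : seq Rn).

(** An entry [(c, r)] of [l] adds [c] to [s(r)], and each occurrence of [p] in [m] adds 1 to [y(p)].
    Repetitions are allowed, so that adding solutions is concatenation. *)
Definition total l m : Rn := \sum_(x <- l) x.1 *: x.2 + \sum_(p <- m) p.

Definition cost psi pi l m : R :=
  \sum_(x <- l) x.1 * psi x.2 + \sum_(p <- m) pi p.

Definition nneg l : bool := all (fun x => 0 <= x.1) l.

Lemma Zn0 : Zn (0 : Rn).
Proof. by move=> i; rewrite mxE. Qed.

Lemma ZnD (z z' : Rn) : Zn z -> Zn z' -> Zn (z + z').
Proof. by move=> zZ z'Z i; rewrite mxE rpredD. Qed.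

Lemma ZnN (z : Rn) : Zn z -> Zn (- z).
Proof. by move=> zZ i; rewrite mxE rpredN. Qed.

Lemma translate_ZnP b p : [set b + z | z in Zn] p <-> Zn (p - b).
Proof.
split=> [[z zZ <-]|pbZ]; first by rewrite addrC addKr.
by exists (p - b) => //; rewrite addrC subrK.
Qed.

Lemma mixed_model_seq b l m : nneg l -> Zn (total l m - b) ->
  mixed_model b (fun r => \sum_(x <- l | x.2 == r) x.1, fun p => count_mem p m).
Proof.
move=> /allP l0 tZ; split => /=.
- apply: (@sub_finite_set _ _ [set` [seq x.2 | x <- l]]) => // r /=.
  apply: contraNT => rl; rewrite big_seq_cond big_pred0// => x.
  apply/negP => /andP[xl /eqP xr].
  by move/negP: rl; apply; rewrite -xr; apply/mapP; exists x.
- apply: (@sub_finite_set _ _ [set` m]) => // p /=.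
  by apply: contraNT => /count_memPn ->.
- by move=> r; rewrite big_seq_cond; apply: sumr_ge0 => x /andP[/l0].
- by apply/translate_ZnP; rewrite (sum_weights id) (sum_count_mem id).
Qed.

Lemma cost_seq psi pi l m :
  \sum_(r \in [set: Rn]) psi r * (\sum_(x <- l | x.2 == r) x.1)
    + \sum_(p \in [set: Rn]) pi p * (count_mem p m)%:R = cost psi pi l m.
Proof.
under eq_fsbigr do rewrite mulrC.
under [X in _ + X]eq_fsbigr do rewrite mulr_natr.
by rewrite sum_count_mem (sum_weights (psi : Rn -> R^o)).
Qed.

Lemma finitely_supported_seq (s : Rn -> R) (y : Rn -> nat) :
  finitely_supported s -> finitely_supported y -> (forall r, 0 <= s r) ->
  exists l m, [/\ nneg l, (forall r, s r = 0) -> l = [::],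
    \sum_(r \in [set: Rn]) s r *: r + \sum_(p \in [set: Rn]) p *+ y p = total l m
    & forall psi pi, \sum_(r \in [set: Rn]) psi r * s r
      + \sum_(p \in [set: Rn]) pi p * (y p)%:R = cost psi pi l m].
Proof.
move=> /finitely_supportedE[u uu su] /finitely_supportedE[v uv yv] s0.
(* Zeros are filtered out so that [l] is empty when [s] vanishes, as it does for points of [I_b]. *)
pose u' := [seq r <- u | s r != 0].
have uu' : uniq u' by rewrite filter_uniq.
have su' r : r \notin u' -> s r = 0.
  rewrite mem_filter negb_and negbK => /orP[/eqP//|]; exact: su.
exists [seq (s r, r) | r <- u'], (flatten [seq nseq (y p) p | p <- v]).
have sumnseq (V : nmodType) (h : Rn -> V) :
    \sum_(p <- flatten [seq nseq (y p) p | p <- v]) h p = \sum_(p <- v) h p *+ y p.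
  rewrite big_flatten big_map; apply: eq_bigr => p _.
  by rewrite big_nseq iter_addr_0.
split.
- by apply/allP => _ /mapP[r _ ->] /=.
- move=> s00; rewrite /u' (eq_filter (a2 := pred0)) ?filter_pred0// => r.
  by rewrite s00 eqxx.
- rewrite (fsbigE u')// => [|r _ /su' ->]; last by rewrite scale0r.
  rewrite (fsbigE v)// => [|p _ /yv ->]; last by rewrite mulr0n.
  rewrite /total sumnseq big_map.
  by congr (_ + _); apply: eq_bigl => r; rewrite in_setT.
- move=> psi pi.
  rewrite (fsbigE u')// => [|r _ /su' ->]; last by rewrite mulr0.
  rewrite (fsbigE v)// => [|p _ /yv ->]; last by rewrite mulr0.
  rewrite /cost sumnseq big_map.
  by congr (_ + _); apply: eq_big => r; rewrite ?in_setT ?mulr_natr// mulrC.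
Qed.

Lemma validM_seqP b psi pi alpha : validM b psi pi alpha <->
  normalized alpha /\
  forall l m, nneg l -> Zn (total l m - b) -> alpha <= cost psi pi l m.
Proof.
split=> -[na v]; split=> //.
- by move=> l m l0 tZ; rewrite -cost_seq; exact/v/mixed_model_seq.
- move=> s y [/= sf yf s0].
  have [l [m [l0 _ -> costE]]] := finitely_supported_seq sf yf s0.
  by move=> /translate_ZnP tZ; rewrite costE; exact: v.
Qed.

Lemma validI_seqP b pi alpha : validI b pi alpha <->
  normalized alpha /\
  forall m, Zn (\sum_(p <- m) p - b) -> alpha <= \sum_(p <- m) pi p.
Proof.
have psum (y : Rn -> nat) : \sum_(p \in [set: Rn]) pi p * (y p)%:R =
    \sum_(p \in [set: Rn]) pi p *+ y p.
  by under eq_fsbigr do rewrite mulr_natr.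
split=> -[na v]; split=> //.
- move=> m tZ; rewrite -sum_count_mem -psum; apply: v.
  have := @mixed_model_seq b [::] m isT.
  rewrite /total big_nil add0r => /(_ tZ); rewrite /integer_model/=.
  by congr (mixed_model _ (_, _)); apply/funext => r; rewrite big_nil.
- move=> y [/= sf yf s0].
  have [l [m [_ /(_ (fun=> erefl)) -> -> costE]]] := finitely_supported_seq sf yf s0.
  move: (costE (fun=> 0) pi); rewrite /cost /total big_nil !add0r.
  rewrite fsbig1 ?add0r => [->|r _]; last by rewrite mul0r.
  by rewrite big_nil add0r => /translate_ZnP; exact: v.
Qed.

Lemma total_cat l l' m m' : total (l ++ l') (m ++ m') = total l m + total l' m'.
Proof. by rewrite /total !big_cat/= addrACA. Qed.

Lemma cost_cat psi pi l l' m m' :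
  cost psi pi (l ++ l') (m ++ m') = cost psi pi l m + cost psi pi l' m'.
Proof. by rewrite /cost !big_cat/= addrACA. Qed.

Lemma total_cons l p m : total l (p :: m) = p + total l m.
Proof. by rewrite /total big_cons addrCA. Qed.

Lemma cost_cons psi pi l p m : cost psi pi l (p :: m) = pi p + cost psi pi l m.
Proof. by rewrite /cost big_cons addrCA. Qed.

Lemma nneg_cat l l' : nneg (l ++ l') = nneg l && nneg l'.
Proof. exact: all_cat. Qed.

End Lists.

(** * Lowering one value, and slopes of minimal functions *)

Section Lowering.
Context {R : realType} {n : nat}.
Local Notation Rn := ('rV[R]_n).
Implicit Types (b p q r : Rn) (psi pi : Rn -> R) (alpha c : R).
Implicit Types (l : seq (R * Rn)) (m : seq Rn).

(** Competitors against which minimality is tested: they differ from [pi] in at most one point. *)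
Definition lower pi p c : Rn -> R := fun q => if q == p then c else pi q.

Lemma lower_le pi p c q : c < pi p -> lower pi p c q <= pi q.
Proof. by move=> cpi; rewrite /lower; case: eqVneq => // ->; exact: ltW. Qed.

Lemma lower_neq pi p c : c < pi p -> lower pi p c <> pi.
Proof.
move=> cpi /(congr1 (@^~ p)); rewrite /lower eqxx => cE.
by rewrite cE ltxx in cpi.
Qed.

(* Each copy of [p] is replaced by the combination [(l0, m0)], which represents
   [p] modulo the integers. *)
Lemma lower_replace psi pi p l0 m0 : nneg l0 -> Zn (total l0 m0 - p) ->
  forall m, exists l' m', [/\ nneg l', Zn (total l' m' - \sum_(q <- m) q) &
    cost psi pi l' m' = \sum_(q <- m) lower pi p (cost psi pi l0 m0) q].
Proof.
move=> l00 tZ; elim=> [|q m [l' [m' [l'0 t'Z c']]]].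
  exists [::], [::]; split=> //.
    by rewrite /total !big_nil addr0 subrr; exact: Zn0.
  by rewrite /cost !big_nil addr0.
rewrite !big_cons /lower; case: eqVneq => [->|_].
  exists (l0 ++ l'), (m0 ++ m'); split.
  - by rewrite nneg_cat l00.
  - by rewrite total_cat opprD addrACA; exact: ZnD.
  - by rewrite cost_cat c'.
exists l', (q :: m'); split=> //.
- by rewrite total_cons opprD addrACA subrr add0r.
- by rewrite cost_cons c'.
Qed.

(** Expanding every copy of [p] once keeps the cost and changes the total by an integer vector, so
    validity of the original [pi] applies, even if [p] occurs in [m0]. *)
Lemma lower_validM b psi pi alpha p l0 m0 :
  validM b psi pi alpha -> nneg l0 -> Zn (total l0 m0 - p) ->
  validM b psi (lower pi p (cost psi pi l0 m0)) alpha.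
Proof.
move=> /validM_seqP[na v] l00 tZ; apply/validM_seqP; split=> // l m lge0 lmZ.
have [l' [m' [l'0 t'Z c']]] := lower_replace psi pi l00 tZ m.
have -> : cost psi (lower pi p (cost psi pi l0 m0)) l m = cost psi pi (l ++ l') m'.
  by rewrite -[in RHS](cat0s m') cost_cat c' /cost big_nil addr0.
apply: v; first by rewrite nneg_cat lge0.
rewrite (_ : _ - b = (total l m - b) + (total l' m' - \sum_(q <- m) q)).
  exact: ZnD.
rewrite [RHS]addrAC; congr (_ - b); rewrite -[in LHS](cat0s m') total_cat.
by rewrite {1 3}/total big_nil addr0 addrACA subrr addr0.
Qed.

Lemma validM_validI b psi pi alpha : validM b psi pi alpha -> validI b pi alpha.
Proof.
move=> /validM_seqP[na v]; apply/validI_seqP; split=> // m.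
by have := v [::] m isT; rewrite /total /cost !big_nil !add0r.
Qed.

Lemma minimalI_le b pi alpha p c :
  minimalI b pi alpha -> validI b (lower pi p c) alpha -> pi p <= c.
Proof.
move=> [_ pimin] v; rewrite leNgt; apply/negP => cpi; apply: pimin.
exists (lower pi p c); split=> //.
- exact: lower_neq.
- by move=> q; exact: lower_le.
Qed.

(** Dropping the copies of 0 leaves the sum of [m] unchanged, so the value at 0 may be set to 0. *)
Lemma minimalI_le0 b pi alpha : minimalI b pi alpha -> pi 0 <= 0.
Proof.
move=> pimin; apply: (minimalI_le pimin).
have [/validI_seqP[na v] _] := pimin.
apply/validI_seqP; split=> // m mZ.
rewrite /lower; under eq_bigr => q _ do rewrite -if_neg.
rewrite -big_mkcond -big_filter; apply: v.
rewrite big_filter big_mkcond/= (eq_bigr id)// => q _.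
by case: eqVneq.
Qed.

Lemma sup_slope_fin_num pi r : (sup_slope pi r < +oo)%E ->
  sup_slope pi r \is a fin_num.
Proof.
move=> slt; rewrite fin_numElt slt andbT.
(* The quotient at [eps = 1] rules out the value [-oo]. *)
apply: (@lt_le_trans _ _ (pi (1 *: r) / 1)%:E); first exact: ltNyr.
by apply: ereal_sup_ubound; exists 1 => /=.
Qed.

Lemma sup_slope_le pi r c :
  (sup_slope pi r <= c%:E)%E <-> forall eps, 0 < eps -> pi (eps *: r) <= eps * c.
Proof.
split=> [/ereal_supP sc eps eps0|sc].
  by rewrite mulrC -ler_pdivrMr// -lee_fin; apply: sc; exists eps.
apply/ereal_supP => _ [eps eps0 <-].
by rewrite lee_fin ler_pdivrMr// mulrC sc.
Qed.

Lemma minimalM_sup_slope b pi alpha :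
  minimalI b pi alpha -> (forall r, (sup_slope pi r < +oo)%E) ->
  minimalM b (fun r => fine (sup_slope pi r)) pi alpha.
Proof.
move=> pimin slt; have [piv pimin'] := pimin.
have psiE r : (fine (sup_slope pi r))%:E = sup_slope pi r.
  by rewrite fineK// sup_slope_fin_num.
split.
  have /validI_seqP[na v] := piv; apply/validM_seqP; split=> // l m /allP l0 lmZ.
  apply: (@le_trans _ _ (\sum_(p <- [seq x.1 *: x.2 | x <- l] ++ m) pi p)).
    by apply: v; rewrite big_cat big_map.
  rewrite big_cat big_map /cost lerD2r big_seq [leRHS]big_seq.
  (* A zero weight is outside the range of the supremum; there [pi 0 <= 0] serves instead. *)
  apply: ler_sum => x /l0; rewrite le_eqVlt => /predU1P[<-|x0].
    by rewrite scale0r mul0r (minimalI_le0 pimin).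
  by apply: (sup_slope_le _ _ _).1 => //; rewrite psiE.
move=> [psi' [pi' [neq psile pile v']]].
have pi'E : pi' = pi.
  apply: contrapT => pineq; apply: pimin'; exists pi'; split=> //.
  exact: validM_validI v'.
apply: neq; rewrite pi'E; congr (_, _); apply/funext => r.
apply/eqP; rewrite eq_le psile/= -lee_fin psiE; apply/sup_slope_le => eps eps0.
(* A single continuous variable of weight [eps] at [r] represents [eps *: r]. *)
have := @lower_validM b psi' pi alpha (eps *: r) [:: (eps, r)] [::].
rewrite -{1}pi'E => /(_ v').
rewrite /nneg /= ltW// /total big_seq1 big_nil addr0 subrr => /(_ isT (@Zn0 _ _)).
rewrite /cost big_seq1 big_nil addr0 => /validM_validI.
exact: minimalI_le.
Qed.

End Lowering.

(** * Minimal functions below a liftable one *)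

Section MinimalLifting.
Context {R : realType} {n : nat}.
Local Notation Rn := ('rV[R]_n).
Implicit Types (b p q r : Rn) (psi pi : Rn -> R) (alpha : R).
Implicit Types (l : seq (R * Rn)) (m : seq Rn).

(* The fractional part of [b - k p], in the continuous variables of the unit
   vectors, completes [k] copies of [p] at a cost bounded independently of
   [k]. *)
Lemma validM_ge0 b psi pi alpha : validM b psi pi alpha -> forall p, 0 <= pi p.
Proof.
move=> /validM_seqP[_ v] p; rewrite leNgt; apply/negP => pip.
pose C := \sum_i `|psi (delta_mx 0 i)|.
(* As [pi p < 0], this bound fails once [k] exceeds [(C - alpha) / - pi p]. *)
suff bound k : alpha <= C + pi p *+ k.
  pose x := (C - alpha) / - pi p.
  have := le_lt_trans (ler_norm x) (archi_boundP (normr_ge0 x)).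
  rewrite ltr_pdivrMr ?oppr_gt0// mulr_natl mulNrn.
  by have := bound (Num.bound `|x|); lra.
pose t i : R := (b - p *+ k) 0 i - (Num.floor ((b - p *+ k) 0 i))%:~R.
have t01 i : 0 <= t i <= 1.
  have := floor_itv ((b - p *+ k) 0 i); rewrite intrD /t; lra.
have := v [seq (t i, delta_mx 0 i) | i <- index_enum 'I_n] (nseq k p).
rewrite /total /cost !big_map !big_nseq !iter_addr_0 => /(_ _ _)/le_trans; apply.
- by apply/allP => _ /mapP[i _ ->] /=; have /andP[] := t01 i.
- have -> : \sum_(i <- index_enum 'I_n) t i *: (delta_mx 0 i : Rn) = \row_i t i.
    by rewrite [RHS]row_sum_delta; apply: eq_bigr => i _; rewrite mxE.
  move=> i; rewrite !mxE /t !mxE.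
  rewrite (_ : _ - _ = - (Num.floor ((b - p *+ k) 0 i))%:~R); last first.
    by rewrite !mxE; ring.
  by rewrite rpredN intr_int.
- rewrite lerD2r; apply: ler_sum => i _; have /andP[t0 t1] := t01 i.
  by apply: le_trans (ler_norm _) _; rewrite normrM ger0_norm// ler_piMl.
Qed.

Definition minimal_pi b psi pi alpha : Prop := validM b psi pi alpha /\
  forall pi', validM b psi pi' alpha -> (forall p, pi' p <= pi p) -> pi' = pi.

(** The pointwise infimum of a chain is finite because valid functions are nonnegative. It is valid
    because a cost involves finitely many values, all approximated by one member of the chain. *)
Lemma exists_minimal_pi b psi pi alpha : validM b psi pi alpha ->
  exists2 pi', minimal_pi b psi pi' alpha & forall p, pi' p <= pi p.
Proof.
move=> piv.
pose T := {f : Rn -> R | validM b psi f alpha /\ forall p, f p <= pi p}.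
have t0 : T by exists pi.
(* The order is reversed: maximal elements for [Le] are minimal functions. *)
pose Le : rel T := fun f g => `[< forall p, sval g p <= sval f p >].
have [||A totA|[pi' [pi'v pi'le]] minpi'] := @ZL_preorder T t0 Le.
- by move=> f; apply/asboolP.
- move=> f g h /asboolP gf /asboolP fh; apply/asboolP => p.
  exact: le_trans (fh p) (gf p).
- have [[f0 Af0]|A0] := pselect (A !=set0); last first.
    by exists t0 => f Af; exfalso; apply: A0; exists f.
  pose E p := [set sval f p | f in A].
  have infE p : has_inf (E p).
    split; first by exists (sval f0 p), f0.
    exists 0 => _ [f _ <-]; have [fv _] := svalP f; exact: validM_ge0 fv p.
  pose g p := inf (E p).
  have gle f p : A f -> g p <= sval f p.
    by move=> Af; apply: ge_inf; [exact: (infE p).2|exists f].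
  have approx e m : 0 < e -> exists2 f, A f &
      \sum_(p <- m) sval f p <= \sum_(p <- m) (g p + e).
    move=> e0; suff [f Af fg] : exists2 f, A f &
        {in m, forall p, sval f p <= g p + e}.
      by exists f => //; rewrite big_seq [leRHS]big_seq; exact: ler_sum.
    elim: m => [|q m [f Af fg]]; first by exists f0.
    have [_ [h Ah <-] /ltW hq] := inf_adherent e0 (infE q).
    have [/asboolP hf|/asboolP fh] := totA _ _ Af Ah.
      exists h => // p; rewrite inE => /predU1P[->//|/fg]; exact: le_trans.
    exists f => // p; rewrite inE => /predU1P[->|/fg//].
    exact: le_trans hq.
  have gv : validM b psi g alpha.
    have /validM_seqP[na _] := piv; apply/validM_seqP; split=> // l m l0 lmZ.
    apply/ler_addgt0Pr => e e0.
    (* The error [e] is split over the entries of [m]; the successor covers an empty [m]. *)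
    have e'0 : 0 < e / (size m).+1%:R by rewrite divr_gt0.
    have [f Af fg] := approx _ m e'0.
    have [/validM_seqP[_ /(_ l m l0 lmZ) fv] _] := svalP f.
    apply: (le_trans fv); rewrite /cost -addrA lerD2l (le_trans fg)//.
    rewrite big_split/= lerD2l big_const_seq count_predT iter_addr_0.
    by rewrite -[_ *+ size m]mulr_natr mulrAC ler_pdivrMr// ler_pM2l// ler_nat.
  have gpi p : g p <= pi p.
    by apply: le_trans (gle _ p Af0) _; have [_] := svalP f0.
  by exists (exist _ g (conj gv gpi)) => f Af; apply/asboolP => p; exact: gle.
- exists pi' => //; split=> // pi2 v2 le2.
  have le2' p : pi2 p <= pi p := le_trans (le2 p) (pi'le p).
  have /(_ _)/asboolP le' := minpi' (exist _ pi2 (conj v2 le2')).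
  apply/funext => p; apply/eqP; rewrite eq_le le2/=; apply: le'.
  exact/asboolP.
Qed.

Lemma minimal_pi_le_cost b psi pi alpha p l m : minimal_pi b psi pi alpha ->
  nneg l -> Zn (total l m - p) -> pi p <= cost psi pi l m.
Proof.
move=> [v piminM] l0 lmZ; rewrite leNgt; apply/negP => cpi.
have := piminM _ (lower_validM v l0 lmZ); apply/not_implyP; split; last exact: lower_neq.
by move=> q; exact: lower_le.
Qed.

(* If [pi p + pi (b - p) = 1 + d] with [d > 0], then [pi p] could be divided by
   [1 + d]. *)
Lemma minimal_pi_symm_pos b psi pi p : minimal_pi b psi pi 1 ->
  0 < pi p -> pi p + pi (b - p) <= 1.
Proof.
move=> pimin a0; have [v piminM] := pimin; rewrite leNgt; apply/negP => gt1.
pose d := pi p + pi (b - p) - 1; have d0 : 0 < d by rewrite subr_gt0.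
have d1 : 0 < 1 + d by lra.
pose c := pi p / (1 + d).
have cd : c * (1 + d) = pi p by rewrite divfK// gt_eqF.
have c0 : 0 < c by rewrite divr_gt0.
have cpi : c < pi p by rewrite -cd; nra.
have := piminM (lower pi p c); apply/not_implyP; split; last first.
  apply/not_implyP; split; last exact: lower_neq.
  by move=> q; exact: lower_le.
have /validM_seqP[na v'] := v; apply/validM_seqP; split=> // l m l0.
pose m' := [seq q <- m | q != p]; pose k := count_mem p m.
have mE (V : nmodType) (h : Rn -> V) :
    \sum_(q <- m) h q = \sum_(q <- m') h q + h p *+ k.
  rewrite (bigID (fun q => q != p))/= big_filter; congr (_ + _).
  under eq_bigl do rewrite negbK.
  by rewrite (eq_bigr (fun=> h p)) ?big_const_seq ?iter_addr_0// => q /eqP ->.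
have totE : total l m = total l m' + p *+ k.
  by rewrite /total (mE _ id) addrA.
have costE : cost psi pi l m = cost psi pi l m' + pi p *+ k.
  by rewrite /cost mE addrA.
have -> : cost psi (lower pi p c) l m = cost psi pi l m' + c *+ k.
  rewrite /cost mE addrA {2}/lower eqxx; congr (_ + _ + _).
  rewrite !big_filter; apply: eq_bigr => q; rewrite /lower.
  by case: eqVneq.
(* The part without [p] represents its own total, where [pi] is nonnegative. *)
have W0 : 0 <= cost psi pi l m'.
  apply: le_trans (minimal_pi_le_cost pimin l0 (_ : Zn (_ - total l m'))).
    exact: validM_ge0 v _.
  by rewrite subrr; exact: Zn0.
move=> lmZ; have := v' _ _ l0 lmZ; rewrite costE => cost1.
case: (k) totE cost1 => [|j] totE cost1; first exact: cost1.
have [ge1|lt1] := lerP 1 (c *+ j.+1); first lra.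
(* Removing one copy of [p] from a solution leaves a representation of [b - p]. *)
have : pi (b - p) <= cost psi pi l (nseq j p ++ m').
  apply: minimal_pi_le_cost pimin l0 _.
  suff -> : total l (nseq j p ++ m') - (b - p) = total l m - b by [].
  rewrite totE -[l in LHS]cat0s total_cat {1}/total big_nil big_nseq iter_addr_0.
  by rewrite add0r opprB addrA mulrSr (addrC (p *+ j)) addrA.
rewrite -[l in cost _ _ l (_ ++ _)]cat0s cost_cat {1}/cost big_nil big_nseq.
rewrite iter_addr_0 add0r -[pi p *+ j]mulr_natr => Wge.
rewrite -[c *+ _]mulr_natr -natr1 in lt1 *.
have : 0 < d * (1 - c * (j%:R + 1)) by rewrite mulr_gt0// subr_gt0.
have : pi p * (j%:R + 1) = c * (j%:R + 1) + d * (c * (j%:R + 1)).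
  by rewrite -cd; ring.
have : d = pi p + pi (b - p) - 1 by [].
move: d c j%:R {W0 v' totE cost1 cd d0 d1 c0 cpi lt1} Wge => d c j'; lra.
Qed.

Lemma minimal_pi_symm b psi pi p : minimal_pi b psi pi 1 ->
  pi p + pi (b - p) <= 1.
Proof.
move=> pimin; have [v _] := pimin; have pi0 := validM_ge0 v.
(* If [pi p = 0], exchange [p] and [b - p]; if both values vanish, the sum is 0. *)
have := pi0 p; rewrite le_eqVlt => /predU1P[p0|]; last exact: (minimal_pi_symm_pos pimin).
have := pi0 (b - p); rewrite le_eqVlt => /predU1P[<-|]; first by rewrite -p0 addr0.
by move=> /(minimal_pi_symm_pos pimin); rewrite subKr addrC.
Qed.

(** A valid [pi' <= pi] tested on the solution [p], [b - p] satisfies [pi' p >= 1 - pi' (b - p) >= 1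
    - pi (b - p) >= pi p]. *)
Lemma minimal_pi_minimalI b psi pi : minimal_pi b psi pi 1 -> minimalI b pi 1.
Proof.
move=> pimin; split; first exact: validM_validI pimin.1.
move=> [pi' [neq le' /validI_seqP[_ v']]]; apply: neq; apply/funext => p.
apply/eqP; rewrite eq_le le'/=.
have := v' [:: p; b - p]; rewrite !big_cons !big_nil !addr0 [p + _]addrC subrK subrr.
move=> /(_ (@Zn0 _ _)); have := minimal_pi_symm p pimin; have := le' (b - p).
lra.
Qed.

Lemma minimal_pi_sup_slope b psi pi alpha r : minimal_pi b psi pi alpha ->
  (sup_slope pi r <= (psi r)%:E)%E.
Proof.
move=> pimin; apply/sup_slope_le => eps eps0.
have := @minimal_pi_le_cost _ _ _ _ (eps *: r) [:: (eps, r)] [::] pimin.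
rewrite /nneg/= ltW// /total /cost !big_seq1 !big_nil !addr0 subrr.
by apply=> //; exact: Zn0.
Qed.

End MinimalLifting.

(** * Liftability and minimal functions of finite slope *)

Theorem proposition2p6 (R : realType) (n : nat) (b : 'rV[R]_n)
    (pi : 'rV[R]_n -> R) (alpha : R) :
  ~ Zn b -> validI b pi alpha -> ~ trivialI pi alpha ->
  (liftable b pi alpha <->
     exists pi' : 'rV[R]_n -> R,
       [/\ minimalI b pi' alpha, forall p, pi' p <= pi p &
           forall r, (sup_slope pi' r < +oo)%E]) /\
  (forall pi' : 'rV[R]_n -> R,
     minimalI b pi' alpha -> (forall p, pi' p <= pi p) ->
     (forall r, (sup_slope pi' r < +oo)%E) ->
     let psi := fun r => fine (sup_slope pi' r) in
     minimalM b psi pi' alpha /\ ~ trivialM psi pi' alpha).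
Proof.
move=> _ _ nontriv; split; last first.
  move=> pi' pimin pile slt psi; split; first exact: minimalM_sup_slope.
  move=> [_ pi'0 a]; apply: nontriv; split=> // p.
  exact: le_trans (pile p).
split=> [[psi v]|[pi' [pimin pile slt]]].
- have alpha1 : alpha = 1.
    have /validM_seqP[[aE|aE|//] _] := v; exfalso; apply: nontriv.
      by split; [exact: validM_ge0 v|right].
    by split; [exact: validM_ge0 v|left].
  rewrite alpha1 in v *.
  have [pi' pimin pile] := exists_minimal_pi v.
  exists pi'; split=> // [|r]; first exact: minimal_pi_minimalI pimin.
  exact: le_lt_trans (minimal_pi_sup_slope r pimin) (ltry _).
(* The lifting of [pi'] also lifts [pi], since raising [pi'] to [pi] only increases costs. *)
- have [/validM_seqP[na v] _] := minimalM_sup_slope pimin slt.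
  exists (fun r => fine (sup_slope pi' r)); apply/validM_seqP; split=> // l m l0.
  move=> /(v _ _ l0)/le_trans; apply.
  by rewrite /cost lerD2l; exact: ler_sum.
Qed.
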